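(* Let $d\ge 3$ be an odd integer. The group $G_d$ is a branch group.
   Context: Let $d\ge 3$ be odd and $X=\{1,\dots,d\}$. Let $T$ be the $d$-regular rooted tree whose vertex set is the set $X^*$ of finite words over $X$, with root the empty word, the children of $u$ being $ux$, $x\in X$; $X^k$ is the $k$-th level. $\mathrm{Aut}(T)$ is the group of root-preserving graph automorphisms of $T$, with product $gh(u)=h(g(u))$ and identity $e$. For $g\in\mathrm{Aut}(T)$ and $u\in X^*$, the section $g|_u\in\mathrm{Aut}(T)$ is determined by $g(uv)=g(u)\,g|_u(v)$ for all $v\in X^*$. The wreath recursion of $g$ is $g=(g|_1,\dots,g|_d)\lambda_g$, where $\lambda_g\in S_d$ is the permutation induced by $g$ on $X$; it determines $g$. The group $G_d\le \mathrm{Aut}(T)$ is generated by $A=\{a_1,\dots,a_d\}$, defined recursively by: for $1\le i\le d-1$, $\lambda_{a_i}=(i\ \,i+1)$, $a_i|_i=a_i$, $a_i|_{i+1}=a_{i+1}$, and $a_i|_x=e$ for all other $x\in X$; and $\lambda_{a_d}=(d\ 1)$, $a_d|_1=a_1$, $a_d|_d=a_d$, and $a_d|_x=e$ for all other $x\in X$. For $G\le \mathrm{Aut}(T)$ and a vertex $u$, $\mathrm{Rist}_{G}(u)$ is the subgroup of elements of $G$ fixing every vertex not of the form $uv$ with $v\in X^*$; $\mathrm{Rist}_{G}(\widehat{k})$ is the subgroup generated by all $\mathrm{Rist}_{G}(u)$, $u\in X^k$. A group $G\le\mathrm{Aut}(T)$ acting transitively on each level $X^k$ is a branch group if the index $[G:\mathrm{Rist}_G(\widehat{k})]$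 is finite for every level $k$. *)

(* Defs.v *)
From HB Require Import structures.
From mathcomp Require Import all_boot perm.
From mathcomp Require Import boolp classical_sets cardinality.

Set Implicit Arguments.
Unset Strict Implicit.
Unset Printing Implicit Defensive.

Local Open Scope classical_set_scope.
Local Open Scope group_scope.

Section Subgroups.
Variable gT : groupType.
Implicit Types G H S : set gT.

Definition subgroup H : Prop := group_closed [in H].

Definition gen_subgroup S : set gT := smallest subgroup S.

(* When H is a subgroup of G, this says that the index [G : H] is finite:
   the set of right cosets H g, g in G, is finite. *)
Definition finite_index G H : Prop :=
  finite_set [set [set h * g | h in H] | g in G].

End Subgroups.

(* The alphabet {1, ..., d} is 'I_d, the letter i being the ordinal i - 1. *)
Definition word (d : nat) := seq 'I_d.

Section TreeAutomorphisms.
Variable d : nat.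
Implicit Types (u v w : word d) (f : word d -> word d) (x : 'I_d).

Definition child u w : Prop := exists x, w = rcons u x.

Definition adjacent u w : Prop := child u w \/ child w u.

Definition tree_aut f : Prop :=
  [/\ bijective f, f [::] = [::]
    & forall u w, adjacent (f u) (f w) <-> adjacent u w].

Record AutT := MkAutT { aut_fun :> word d -> word d; _ : `[< tree_aut aut_fun >] }.

HB.instance Definition _ := [isSub for aut_fun].
HB.instance Definition _ := [Choice of AutT by <:].

Lemma AutTP (g : AutT) : tree_aut g.
Proof. by case: g => f /= /asboolP. Qed.

Lemma AutT_eq (g h : AutT) : g =1 h -> g = h.
Proof. by move=> e; apply/val_inj/funext. Qed.

Lemma tree_aut_id : tree_aut id.
Proof. by split=> //; exists id. Qed.

Lemma tree_aut_comp f1 f2 : tree_aut f1 -> tree_aut f2 -> tree_aut (f2 \o f1).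
Proof.
move=> [b1 e1 a1] [b2 e2 a2]; split=> /= [||u w].
- exact: bij_comp.
- by rewrite e1.
- by rewrite a2.
Qed.

Lemma tree_aut_inv f f' :
  cancel f f' -> cancel f' f -> tree_aut f -> tree_aut f'.
Proof.
move=> fK f'K [_ e a]; split; first by exists f.
- by rewrite -e fK.
- by move=> u w; rewrite -a !f'K.
Qed.

Definition aut_inv_fun (g : AutT) w : word d := xget w [set v | g v = w].

Lemma aut_inv_funK (g : AutT) : cancel (aut_inv_fun g) g.
Proof.
move=> w; rewrite /aut_inv_fun; case: xgetP => [v _ //|nex].
by have [[g' _ gK] _ _] := AutTP g; case: (nex (g' w)); rewrite /= gK.
Qed.

Lemma aut_funK (g : AutT) : cancel g (aut_inv_fun g).
Proof. by have [/bij_inj gI _ _] := AutTP g; move=> w; apply: gI; rewrite aut_inv_funK. Qed.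

Definition aut_one : AutT := MkAutT (asboolT tree_aut_id).

Definition aut_mul (g h : AutT) : AutT :=
  MkAutT (asboolT (tree_aut_comp (AutTP g) (AutTP h))).

Definition aut_inv (g : AutT) : AutT :=
  MkAutT (asboolT (tree_aut_inv (@aut_funK g) (@aut_inv_funK g) (AutTP g))).

Lemma aut_mulA : associative aut_mul.
Proof. by move=> g h k; apply: AutT_eq. Qed.

Lemma aut_mul1 : left_id aut_one aut_mul.
Proof. by move=> g; apply: AutT_eq. Qed.

Lemma aut_mulr1 : right_id aut_one aut_mul.
Proof. by move=> g; apply: AutT_eq. Qed.

Lemma aut_mulV : left_inverse aut_one aut_inv aut_mul.
Proof. by move=> g; apply: AutT_eq => w /=; rewrite aut_inv_funK. Qed.

Lemma aut_mulrV : right_inverse aut_one aut_inv aut_mul.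
Proof. by move=> g; apply: AutT_eq => w /=; rewrite aut_funK. Qed.

HB.instance Definition _ :=
  isGroup.Build AutT aut_mulA aut_mul1 aut_mulr1 aut_mulV aut_mulrV.

Lemma aut_mulE (g h : AutT) u : (g * h) u = h (g u).
Proof. by []. Qed.

Implicit Type G : set AutT.

Definition Rist G u : set AutT :=
  [set g | G g /\ forall w, ~~ prefix u w -> g w = w].

Definition Rist_level G (k : nat) : set AutT :=
  gen_subgroup (\bigcup_(u in [set u : word d | size u = k]) Rist G u).

Definition level_transitive G : Prop :=
  forall (k : nat) u w, size u = k -> size w = k -> exists2 g, G g & g u = w.

Definition branch_group G : Prop :=
  [/\ subgroup G, level_transitive G
    & forall k : nat, finite_index G (Rist_level G k)].

End TreeAutomorphisms.

Section Gd.
Variable d : nat.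
Implicit Types (u v w : word d) (x i : 'I_d).

(* g(xv) = lambda_g(x) g|_x(v) for g = a_i; the successor ordS is cyclic, so
   i = d - 1 is the generator a_d, with transposition (d 1). *)
Fixpoint gen_fun i w : word d :=
  if w is x :: v then
    tperm i (ordS i) x ::
      (if x == i then gen_fun i v
       else if x == ordS i then gen_fun (ordS i) v
       else v)
  else [::].

Fixpoint gen_inv_fun i w : word d :=
  if w is y :: v then
    let x := tperm i (ordS i) y in
    x :: (if x == i then gen_inv_fun i v
          else if x == ordS i then gen_inv_fun (ordS i) v
          else v)
  else [::].

Lemma gen_funK i : cancel (gen_fun i) (gen_inv_fun i).
Proof.
move=> w; elim: w i => //= x v IH i; rewrite tpermK; congr (_ :: _).
by case: eqP => _; [|case: eqP].
Qed.

Lemma gen_inv_funK i : cancel (gen_inv_fun i) (gen_fun i).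
Proof.
move=> w; elim: w i => //= x v IH i; rewrite tpermK; congr (_ :: _).
by case: eqP => _; [|case: eqP].
Qed.

Lemma gen_fun_child i u w : child u w -> child (gen_fun i u) (gen_fun i w).
Proof.
case=> x ->; elim: u i => [|y u IH] i /=; first by eexists; case: ifP => _; [|case: ifP].
have [z1 e1] := IH i; have [z2 e2] := IH (ordS i).
by case: eqP => _; [exists z1; rewrite e1|case: eqP => _; [exists z2; rewrite e2|exists x]].
Qed.

Lemma gen_inv_fun_child i u w :
  child u w -> child (gen_inv_fun i u) (gen_inv_fun i w).
Proof.
case=> x ->; elim: u i => [|y u IH] i /=; first by eexists; case: ifP => _; [|case: ifP].
have [z1 e1] := IH i; have [z2 e2] := IH (ordS i).
by case: eqP => _; [exists z1; rewrite e1|case: eqP => _; [exists z2; rewrite e2|exists x]].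
Qed.

Lemma tree_aut_gen i : tree_aut (gen_fun i).
Proof.
split=> //; first by exists (gen_inv_fun i); [apply: gen_funK|apply: gen_inv_funK].
move=> u w; split=> -[]; last 2 first.
- by left; apply: gen_fun_child.
- by right; apply: gen_fun_child.
- by move=> /(gen_inv_fun_child i); rewrite !gen_funK; left.
- by move=> /(gen_inv_fun_child i); rewrite !gen_funK; right.
Qed.

Definition gen i : AutT d := MkAutT (asboolT (tree_aut_gen i)).

Definition Gd : set (AutT d) := gen_subgroup (range gen).

End Gd.

Arguments Gd d : clear implicits.

(* Main.v *)
Require Import Defs.
From mathcomp Require Import all_boot perm.
From mathcomp Require Import boolp classical_sets cardinality.

Set Implicit Arguments.
Unset Strict Implicit.
Unset Printing Implicit Defensive.

(** Let R be the set of sections at a letter p of the elements of G = G_d that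
    fix every word not beginning with p. The heart of the proof is that R has
    finite index in G.

    The element a_p^-1 a_{p+1} takes the letter p to p+2 with trivial section.
    Since d is odd, steps of length two reach every letter of the cycle, so
    every section k in G is realized by an element of G taking p to q, for all
    letters p and q (reaches_all). Hence G is transitive on the levels, and R is
    normal in G and does not depend on p (rigid_letterJ).

    The element a_i^2 has sections x = a_i a_{i+1} at i, y = a_{i+1} a_i at i+1,
    and 1 elsewhere; such elements with two nontrivial sections are moved around
    the cycle by conjugation. With p = i-1 this gives elements of G with the
    sections
      A : x at i, y at i+1;        B : x at p, x at i;
      B' : x at p, y at i+1;       C : y at p, y at i+1.
    Then B' C^-1 and A B B'^-1 have a single nontrivial section, namely x y^-1
    and x^2, so both lie in R (gen_pair_relations). If two such elements overlap
    in a single letter, their commutator is supported there; hence the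
    products a_i a_{i+1} commute with each other modulo R (gen_pair_comm). These relations make G/R abelian, with
    a_{i+1}^2 = a_i^-2 in it; going around the odd cycle, a_i^4 lies in R, so G/R
    is a finitely generated abelian group of exponent dividing 4, hence finite
    (index_finite_letter).

    For a longer word p u, an element h that is a section at u of the rigid
    stabilizer of u lifts to some g in G; requiring that g in turn lie in R is
    a condition of finite index on h. So by induction the sections at u of the
    rigid stabilizer of u have finite index in G for every word u
    (index_finite_rigid). Finally, the action on level n together with the
    classes of the sections at the words of level n takes finitely many values,
    and it determines an element of G modulo the level rigid stabilizer. *)

(** * Subgroups and finite index *)

Section Subgroups.
Local Open Scope classical_set_scope.
Local Open Scope group_scope.
Variable gT : groupType.
Implicit Types (G H A B C R : set gT) (g h s t r : gT).

Lemma subgroupP H :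
  subgroup H <-> H 1 /\ forall g h, H g -> H h -> H (g * h^-1).
Proof.
split=> -[H1 HD]; split; rewrite ?inE // in H1 *.
- by move=> g h Hg Hh; have := HD g h; rewrite !inE; apply.
- by move=> g h; rewrite !inE; apply: HD.
Qed.

Lemma subgroup1 H : subgroup H -> H 1.
Proof. by case/subgroupP. Qed.

Lemma subgroupV H g : subgroup H -> H g -> H g^-1.
Proof. by case/subgroupP=> H1 HD Hg; rewrite -[g^-1]mul1g; apply: HD. Qed.

Lemma subgroupM H g h : subgroup H -> H g -> H h -> H (g * h).
Proof.
move=> sH Hg Hh; rewrite -[h]invgK; have [_ HD] := (subgroupP H).1 sH.
by apply: HD => //; apply: subgroupV.
Qed.

Lemma subgroupX H g n : subgroup H -> H g -> H (g ^+ n).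
Proof.
move=> sH Hg; elim: n => [|n IH]; first by rewrite expg0; apply: subgroup1.
by rewrite expgS; apply: subgroupM.
Qed.

Lemma subgroupJ H g h : subgroup H -> H g -> H h -> H (g ^ h).
Proof. by move=> sH Hg Hh; rewrite conjgE; do !apply: subgroupM => //; apply: subgroupV. Qed.

Lemma gen_subgroup_subgroup A : subgroup (gen_subgroup A).
Proof.
apply/subgroupP; split=> [H [sH _]|g h Ag Ah H HA]; first exact: subgroup1.
have [sH _] := HA.
by apply: subgroupM => //; [apply: Ag | apply: subgroupV => //; apply: Ah].
Qed.

Lemma mem_gen_subgroup A g : A g -> gen_subgroup A g.
Proof. exact: sub_gen_smallest. Qed.

Lemma gen_subgroup_ind A H :
  subgroup H -> A `<=` H -> gen_subgroup A `<=` H.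
Proof. exact: smallest_sub. Qed.

(** A classifying map to a finite type; this form of finiteness pulls back and
    combines more easily than a finite set of cosets. *)
Definition finitely_many_classes (T : Type) (A : set T) (E : T -> T -> Prop) :=
  exists (F : finType) (phi : T -> F),
    forall x y : T, A x -> A y -> phi x = phi y -> E x y.

Definition index_finite A B := finitely_many_classes A (fun g h => B (g * h^-1)).

Lemma finitely_many_classes_all (T : Type) (I : eqType) (l : seq I) (A : set T)
    (E : I -> T -> T -> Prop) :
  (forall i, i \in l -> finitely_many_classes A (E i)) ->
  finitely_many_classes A (fun x y => forall i, i \in l -> E i x y).
Proof.
elim: l => [|i l IH] Efin; first by exists unit, (fun=> tt).
have [j lj|F [phi phiP]] := IH; first by apply: Efin; rewrite inE lj orbT.
have [|F' [psi psiP]] := Efin i; first by rewrite inE eqxx.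
exists (F' * F)%type, (fun x => (psi x, phi x)) => x y Ax Ay [e1 e2] j.
by rewrite inE => /orP[/eqP->|lj]; [apply: psiP | apply: phiP].
Qed.

Lemma index_finite_trans A B C :
  index_finite A B -> index_finite B C -> index_finite A C.
Proof.
move=> [F [phi phiP]] [F' [psi psiP]].
pose r g := xget 1 [set h | A h /\ phi h = phi g].
have rP g : A g -> A (r g) /\ phi (r g) = phi g.
  by move=> Ag; apply: (xgetPex 1 (P := [set h | A h /\ phi h = phi g])); exists g.
exists (F * F')%type, (fun g => (phi g, psi (g * (r g)^-1))) => g h Ag Ah [e].
have -> : r h = r g by rewrite /r e.
have [Ar er] := rP g Ag; move=> /psiP P.
have := P (phiP _ _ Ag Ar (esym er)) (phiP _ _ Ah Ar _); rewrite er => /(_ (esym e)).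
by rewrite invgM invgK mulgA mulgVK.
Qed.

Lemma index_finite_finite_index A B :
  subgroup B -> index_finite A B -> finite_index A B.
Proof.
move=> sB [F [phi phiP]].
pose r i := xget 1 [set g | A g /\ phi g = i].
apply: (@sub_finite_set _ _ ((fun i => [set h * r i | h in B]) @` [set: F])); last first.
  by apply: finite_image; apply: finite_finset.
move=> _ [g Ag <-]; exists (phi g) => //.
have [Ar er] : A (r (phi g)) /\ phi (r (phi g)) = phi g.
  by apply: (xgetPex 1 (P := [set h | A h /\ phi h = phi g])); exists g.
have Brg := phiP _ _ Ar Ag er.
apply/seteqP; split=> _ [h Bh <-].
- by exists (h * (r (phi g) * g^-1)); [apply: subgroupM | rewrite !mulgA mulgVK].
- exists (h * (g * (r (phi g))^-1)); last by rewrite !mulgA mulgVK.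
  by apply: subgroupM => //; rewrite -[g * _]invgK invgM invgK; apply: subgroupV.
Qed.

Variables (G R : set gT).
Hypotheses (sG : subgroup G) (sR : subgroup R).
Hypothesis nR : forall r g, R r -> G g -> R (r ^ g).

(** The centralizer of s modulo R, as a subgroup of G: commutation modulo R with
    some generators spreads to all the elements that they generate. *)
Definition centralizer_mod s : set gT := [set g | G g /\ R [~ s, g]].

Lemma centralizer_mod_subgroup s : G s -> subgroup (centralizer_mod s).
Proof.
move=> Gs; apply/subgroupP; split.
  by split; [apply: subgroup1 | rewrite commg1; apply: subgroup1].
move=> g h [Gg Rg] [Gh Rh]; have Gh' := subgroupV sG Gh.
split; first exact: subgroupM.
have -> : [~ s, g * h^-1] = ([~ s, h]^-1 * [~ s, g]) ^ h^-1.
  by rewrite !(commgEl, conjgE, invgM, invgK, mulgA, mulgK, mulgVK, mulgV, mulVg, mul1g).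
by apply: nR => //; apply: subgroupM => //; apply: subgroupV.
Qed.

Lemma centralizer_mod_sym s t :
  G s -> centralizer_mod s t -> centralizer_mod t s.
Proof.
by move=> Gs [_ Rst]; split=> //; rewrite -invgR; apply: subgroupV.
Qed.

Lemma mod_conjC g h : G g -> R (g * h) -> R (h * g).
Proof.
move=> Gg Rgh; have -> : h * g = (g * h) ^ g by rewrite conjgE !mulgA mulVg mul1g.
exact: nR.
Qed.

Lemma mod_sqr_mul g h :
  G h -> R [~ g, h] -> R ((g * h) ^+ 2) -> R (g ^+ 2 * h ^+ 2).
Proof.
move=> Gh Rc Rs.
have -> : g ^+ 2 * h ^+ 2 = (g * h) ^+ 2 * [~ g, h] ^ h.
  by rewrite !(expg2, commgEl, conjgE, invgM, invgK, mulgA, mulgK, mulgVK, mulgV, mulVg, mul1g).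
by apply: subgroupM => //; apply: nR.
Qed.

(** An abelian group generated by finitely many elements of bounded order is
    finite: the products of powers s ^+ k with k < n, taken in the order of the
    list, represent all the cosets. *)
Lemma abelian_torsion_reps (n : nat) (l : seq gT) :
  0 < n -> (forall s, s \in l -> G s) ->
  (forall s t, s \in l -> t \in l -> R [~ s, t]) ->
  (forall s, s \in l -> R (s ^+ n)) ->
  exists reps : seq gT, [/\ 1 \in reps, forall r, r \in reps -> G r &
    forall s r, s \in l -> r \in reps ->
      exists2 r', r' \in reps & R (s * r * r'^-1)].
Proof.
move=> n0; elim: l => [|s l IH] Gl Rl Xl.
  exists [:: 1]; split=> [|r|s r]; rewrite ?inE ?eqxx // => /eqP ->; exact: subgroup1.
have l_s t : t \in l -> t \in s :: l by rewrite inE orbC => ->.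
have ss : s \in s :: l by rewrite inE eqxx.
have [|||reps [r1 Gr rP]] := IH; [by auto ..|].
exists [seq s ^+ k * r | k <- iota 0 n, r <- reps]; split.
- by apply/allpairsP; exists (0, 1); rewrite mem_iota /= expg0 mul1g.
- move=> _ /allpairsP[[k r] /= [_ rr ->]].
  by apply: subgroupM => //; [apply: subgroupX => //; apply: Gl | apply: Gr].
move=> t r0; rewrite inE => lt /allpairsP[[k r] /= [+ rr ->]].
rewrite mem_iota /= add0n => kn; case/orP: lt => [/eqP->|lt].
- have [kn1|nk] := ltnP k.+1 n.
    exists (s ^+ k.+1 * r); first by apply/allpairsP; exists (k.+1, r); rewrite mem_iota.
    by rewrite mulgA -expgS mulgV; apply: subgroup1.
  exists r; first by apply/allpairsP; exists (0, r); rewrite mem_iota /= expg0 mul1g.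
  have kn' : k.+1 = n by apply/eqP; rewrite eqn_leq nk kn.
  by rewrite mulgA -expgS mulgK kn'; apply: Xl.
- have [r' rr' Rr'] := rP t r lt rr.
  exists (s ^+ k * r'); first by apply/allpairsP; exists (k, r'); rewrite mem_iota.
  have Gs := Gl _ ss; have Gt := Gl _ (l_s _ lt).
  have cst : centralizer_mod s t.
    by split=> //; apply: Rl => //; apply: l_s.
  have ct : centralizer_mod t^-1 (s ^+ k)^-1.
    have ct : centralizer_mod t^-1 s.
      by apply: centralizer_mod_sym => //; apply: (subgroupV (centralizer_mod_subgroup Gs)).
    have sc := centralizer_mod_subgroup (subgroupV sG Gt).
    by apply: subgroupV => //; apply: subgroupX.
  have -> : t * (s ^+ k * r) * (s ^+ k * r')^-1
     = [~ t^-1, (s ^+ k)^-1] * (t * r * r'^-1) ^ (s ^+ k)^-1.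
    rewrite [t * (_ * _)]mulgA (commgCV t (s ^+ k)).
    by rewrite conjgE invgM invgK !mulgA.
  apply: subgroupM => //; first by case: ct.
  by apply: nR => //; apply: subgroupV => //; apply: subgroupX.
Qed.

Lemma abelian_torsion_index_finite (n : nat) (l : seq gT) :
  0 < n -> G `<=` gen_subgroup [set s | s \in l] ->
  (forall s, s \in l -> G s) ->
  (forall s t, s \in l -> t \in l -> R [~ s, t]) ->
  (forall s, s \in l -> R (s ^+ n)) ->
  index_finite G R.
Proof.
move=> n0 Ggen Gl Rl Xl.
have [reps [r1 Gr rP]] := abelian_torsion_reps n0 Gl Rl Xl.
pose K g := G g /\ forall r, r \in reps -> exists2 r', r' \in reps & R (g * r * r'^-1).
have KM g h : K g -> K h -> K (g * h).
  move=> [Gg Kg] [Gh Kh]; split=> [|r rr]; first exact: subgroupM.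
  have [r' rr' Rr'] := Kh r rr; have [r'' rr'' Rr''] := Kg r' rr'.
  exists r'' => //.
  have -> : g * h * r * r''^-1 = (h * r * r'^-1) ^ g^-1 * (g * r' * r''^-1).
    by rewrite conjgE invgK !mulgA !mulgVK.
  by apply: subgroupM => //; apply: nR => //; apply: subgroupV.
have K1 : K 1.
  split=> [|r rr]; first exact: subgroup1.
  by exists r => //; rewrite mul1g mulgV; apply: subgroup1.
have Kl s : s \in l -> K s by move=> ls; split; [apply: Gl | move=> r; apply: rP].
have KX s k : s \in l -> K (s ^+ k).
  by move=> ls; elim: k => [|k IH]; rewrite ?expg0 // expgS; apply: KM => //; apply: Kl.
(* modulo R, the inverse of a generator is its power n - 1 *)
have KV s : s \in l -> K s^-1.
  move=> ls; split=> [|r rr]; first by apply: subgroupV => //; apply: Gl.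
  have [_ /(_ r rr)[r' rr' Rr']] := KX s n.-1 ls; exists r' => //.
  have -> : s^-1 * r * r'^-1 = (s ^+ n)^-1 * (s ^+ n.-1 * r * r'^-1).
    by rewrite -{1}(prednK n0) expgSr invgM !mulgA mulgVK.
  by apply: subgroupM => //; apply: subgroupV => //; apply: Xl.
have GK : G `<=` K.
  move=> g /Ggen Gg; suff [] : K g /\ K g^-1 by [].
  apply: (gen_subgroup_ind (H := [set g | K g /\ K g^-1])) Gg => [|s ls]; last first.
    by split; [apply: Kl | apply: KV].
  apply/subgroupP; split; first by rewrite /= invg1.
  by move=> g1 g2 [? ?] [? ?]; split; rewrite /= ?invgM ?invgK; apply: KM.
pose near g r := `[< R (g * r^-1) >].
exists 'I_(size reps).+1, (fun g => inord (find (near g) reps)) => g h Gg Gh.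
have rep x : G x -> R (x * (nth 1 reps (find (near x) reps))^-1).
  move=> Gx; apply/asboolP/(nth_find 1 (a := near x)).
  apply/hasP; have [_ /(_ 1 r1)[r rr Rr]] := GK x Gx; exists r => //.
  by apply/asboolP; rewrite -[x]mulg1.
move/(congr1 (@nat_of_ord _)); rewrite !inordK ?ltnS ?find_size //= => e.
have := rep g Gg; have := rep h Gh; rewrite e; set r := nth _ _ _ => Rh Rg.
have -> : g * h^-1 = (g * r^-1) * (h * r^-1)^-1 by rewrite invgM invgK mulgA mulgVK.
by apply: subgroupM => //; apply: subgroupV.
Qed.

End Subgroups.

(** * Sections *)

Section Sections.
Local Open Scope classical_set_scope.
Local Open Scope group_scope.
Variable d : nat.
Implicit Types (g h k t c b : AutT d) (u v w : word d) (p q r i j : 'I_d).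

(** The section is kept as a relation between g, a vertex and its image, so that
    products and inverses compose as in a groupoid, without a section function. *)
Definition carries g u w h := forall v, g (u ++ v) = w ++ h v.

Lemma aut_nil g : g [::] = [::].
Proof. by have [_ ->] := AutTP g. Qed.

Lemma carries_aut g u w h : carries g u w h -> g u = w.
Proof. by move/(_ [::]); rewrite aut_nil !cats0. Qed.

Lemma carries1 u : carries 1 u u 1.
Proof. by []. Qed.

Lemma carriesM g h u v w k t :
  carries g u v k -> carries h v w t -> carries (g * h) u w (k * t).
Proof. by move=> e f z; rewrite !aut_mulE e f. Qed.

Lemma carriesV g u w k : carries g u w k -> carries g^-1 w u k^-1.
Proof.
move=> e z; rewrite -{1}[z](aut_inv_funK k) -e.
by rewrite -[LHS]/((g * g^-1) _) mulgV.
Qed.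

Lemma carriesJ g t u w c k :
  carries g u u c -> carries t u w k -> carries (g ^ t) w w (c ^ k).
Proof.
by move=> gc tk; apply: carriesM (carriesV tk) (carriesM gc tk).
Qed.

Lemma carries_cat g h u u' w w' k :
  carries g u w h -> carries h u' w' k -> carries g (u ++ u') (w ++ w') k.
Proof. by move=> e f z; rewrite -catA e f catA. Qed.

(** Rigid stabilizers of longer words are obtained from those of shorter ones: g
    only moves words x w, and among them only those for which h moves w. *)
Lemma Rist_cat G g h x u c :
  carries g x x h -> Rist G x g -> carries h u u c ->
  (forall w, ~~ prefix u w -> h w = w) ->
  Rist G (x ++ u) g /\ carries g (x ++ u) (x ++ u) c.
Proof.
move=> gh [Gg g1] hc h1; split; last exact: carries_cat gh hc.
split=> // w nw; have [/prefixP[w' e]|] := boolP (prefix x w); last exact: g1.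
by rewrite e gh h1 //; apply: contra nw => /prefixP[z ez]; rewrite e ez catA prefix_prefix.
Qed.

Lemma Rist_subgroup (G : set (AutT d)) u : subgroup G -> subgroup (Rist G u).
Proof.
move=> sG; apply/subgroupP; split; first by split=> //; apply: subgroup1.
move=> g h [Gg g1] [Gh h1]; split; first by apply: subgroupM => //; apply: subgroupV.
move=> w nw; rewrite aut_mulE g1 // -{1}(h1 w nw).
by rewrite -[LHS]/((h * h^-1) w) mulgV.
Qed.

End Sections.

(** * The group G_d is self-similar and self-replicating *)

Section SelfSimilar.
Local Open Scope classical_set_scope.
Local Open Scope group_scope.
Variable d : nat.
Implicit Types (g h k t c b : AutT d) (u v w : word d) (p q r i j : 'I_d).

Lemma Gd_subgroup : subgroup (Gd d).
Proof. exact: gen_subgroup_subgroup. Qed.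

Lemma Gd1 : Gd d 1.
Proof. exact: subgroup1 Gd_subgroup. Qed.

Lemma GdV g : Gd d g -> Gd d g^-1.
Proof. exact: subgroupV Gd_subgroup. Qed.

Lemma GdM g h : Gd d g -> Gd d h -> Gd d (g * h).
Proof. exact: subgroupM Gd_subgroup. Qed.

Lemma Gd_gen i : Gd d (gen i).
Proof. by apply: mem_gen_subgroup; exists i. Qed.

Lemma Gd_ind (H : set (AutT d)) :
  subgroup H -> (forall i, H (gen i)) -> Gd d `<=` H.
Proof. by move=> sH Hi; apply: gen_subgroup_ind => // _ [i _ <-]. Qed.

Lemma gen_carriesL i : carries (gen i) [:: i] [:: ordS i] (gen i).
Proof. by move=> v; rewrite /= tpermL eqxx. Qed.

Lemma gen_carriesR i : ordS i != i -> carries (gen i) [:: ordS i] [:: i] (gen (ordS i)).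
Proof. by move=> ne v; rewrite /= tpermR eqxx (negbTE ne). Qed.

Lemma gen_carriesD i r : r != i -> r != ordS i -> carries (gen i) [:: r] [:: r] 1.
Proof.
by move=> ri rS v; rewrite /= (negbTE ri) (negbTE rS) tpermD // eq_sym.
Qed.

Lemma gen_section i p :
  exists h, Gd d h /\ carries (gen i) [:: p] [:: tperm i (ordS i) p] h.
Proof.
have [->|pi] := eqVneq p i.
  by exists (gen i); split; [apply: Gd_gen | rewrite tpermL; apply: gen_carriesL].
have [pS|pS] := eqVneq p (ordS i).
  exists (gen (ordS i)); split; first exact: Gd_gen.
  by rewrite pS tpermR; apply: gen_carriesR; rewrite -pS.
exists 1; split; first exact: Gd1.
by rewrite tpermD 1?eq_sym //; apply: gen_carriesD.
Qed.

(** Both the image of each letter and the preimage of each letter are recorded: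
    the second half is what makes the property pass to inverses. *)
Lemma Gd_section1 g : Gd d g ->
  (forall p, exists q h, Gd d h /\ carries g [:: p] [:: q] h) /\
  (forall q, exists p h, Gd d h /\ carries g [:: p] [:: q] h).
Proof.
move=> Gg; pose H : set (AutT d) := [set g |
  (forall p, exists q h, Gd d h /\ carries g [:: p] [:: q] h) /\
  (forall q, exists p h, Gd d h /\ carries g [:: p] [:: q] h)].
apply: (Gd_ind (H := H)) Gg => [|i]; last first.
  split=> p; first by exists (tperm i (ordS i) p); apply: gen_section.
  exists (tperm i (ordS i) p); have := gen_section i (tperm i (ordS i) p).
  by rewrite tpermK.
have GD h k : Gd d h -> Gd d k -> Gd d (h * k^-1).
  by move=> Gh Gk; apply: GdM Gh (GdV Gk).
apply/subgroupP; split; first by split=> p; exists p, 1; split; try exact: Gd1.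
move=> g1 g2 [g1d g1r] [g2d g2r]; split=> p.
- have [q [h [Gh gh]]] := g1d p; have [r [k [Gk gk]]] := g2r q.
  exists r, (h * k^-1); split; first exact: GD.
  exact: carriesM gh (carriesV gk).
- have [q [h [Gh gh]]] := g2d p; have [r [k [Gk gk]]] := g1r q.
  exists r, (k * h^-1); split; first exact: GD.
  exact: carriesM gk (carriesV gh).
Qed.

Lemma Gd_section g u : Gd d g ->
  exists w h, [/\ size w = size u, Gd d h & carries g u w h].
Proof.
elim: u g => [|p u IH] g Gg; first by exists [::], g; split=> // v.
have [q [h [Gh gh]]] := (Gd_section1 Gg).1 p.
have [w [k [sw Gk hk]]] := IH h Gh.
exists (q :: w), k; split=> //=; first by rewrite sw.
exact: (carries_cat (u := [:: p]) (w := [:: q]) gh hk).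
Qed.

Hypotheses (d3 : 3 <= d) (dodd : odd d).

Lemma iter_ordS n i : nat_of_ord (iter n (@ordS d) i) = (i + n) %% d.
Proof.
elim: n => [|n IH]; first by rewrite addn0 modn_small.
by rewrite iterS /= IH -addn1 modnDml addn1 addnS.
Qed.

Lemma iter_ordS_neq n i : 0 < n < d -> iter n (@ordS d) i != i.
Proof.
case/andP=> n0 nd; rewrite -val_eqE /= iter_ordS -{2}(modn_small (ltn_ord i)).
by rewrite -{2}[nat_of_ord i]addn0 eqn_modDl mod0n modn_small // -lt0n.
Qed.

Lemma ordS_neq i : ordS i != i.
Proof. by apply: (iter_ordS_neq (n := 1)); rewrite (ltn_trans _ d3). Qed.

Lemma ordSS_neq i : ordS (ordS i) != i.
Proof. exact: (iter_ordS_neq (n := 2)). Qed.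

Lemma ordS_ind (P : 'I_d -> Prop) i :
  P i -> (forall j, P j -> P (ordS j)) -> forall j, P j.
Proof.
move=> Pi PS j; have -> : j = iter (j + (d - i)) (@ordS d) i.
  apply: val_inj; rewrite /= iter_ordS addnCA subnKC ?modnDr ?modn_small //.
  exact: ltnW.
by elim: (_ + _) => //= n; apply: PS.
Qed.

(** As d is odd, steps of length two run through the whole cycle. *)
Lemma ordSS_ind (P : 'I_d -> Prop) i :
  P i -> (forall j, P j -> P (ordS (ordS j))) -> forall j, P j.
Proof.
move=> Pi PSS; have P2 n j : P j -> P (iter n.*2 (@ordS d) j).
  by move=> Pj; elim: n => //= n; apply: PSS.
apply: (ordS_ind Pi) => j /(P2 (d.+1)./2).
have -> : (d.+1)./2.*2 = d.+1 by have := odd_double_half d.+1; rewrite /= dodd.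
suff -> : iter d.+1 (@ordS d) j = ordS j by [].
by apply: val_inj; rewrite /= iter_ordS modnDr (modn_small (ltn_ord j)).
Qed.

(** On letters this is the 3-cycle p -> p+2 -> p+1 -> p. It is used because its
    section at p is trivial: p+2 is reached from p without paying a section. *)
Definition skip p := (gen p)^-1 * gen (ordS p).

Lemma Gd_skip p : Gd d (skip p).
Proof. by apply: GdM; [apply: GdV|]; apply: Gd_gen. Qed.

Lemma skip_carries0 p : carries (skip p) [:: p] [:: ordS (ordS p)] 1.
Proof.
rewrite -(mulVg (gen (ordS p))).
exact: carriesM (carriesV (gen_carriesR (ordS_neq p))) (gen_carriesL _).
Qed.

Lemma skip_carries1 p : carries (skip p) [:: ordS p] [:: p] (gen p)^-1.
Proof.
rewrite -[X in carries _ _ _ X]mulg1.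
apply: carriesM (carriesV (gen_carriesL p)) (gen_carriesD _ _); rewrite eq_sym.
- exact: ordS_neq.
- exact: ordSS_neq.
Qed.

Lemma skip_carries2 p :
  carries (skip p) [:: ordS (ordS p)] [:: ordS p] (gen (ordS (ordS p))).
Proof.
rewrite -[X in carries _ _ _ X]mul1g -invg1.
apply: carriesM (carriesV (gen_carriesD _ _)) (gen_carriesR (ordS_neq _)).
- exact: ordSS_neq.
- exact: ordS_neq.
Qed.

Lemma skip_carriesD p r :
  r != p -> r != ordS p -> r != ordS (ordS p) -> carries (skip p) [:: r] [:: r] 1.
Proof.
move=> r0 r1 r2; rewrite -[X in carries _ _ _ X]mulg1 -{1}invg1.
by apply: carriesM (carriesV (gen_carriesD _ _)) (gen_carriesD _ _).
Qed.

Definition reaches p q k := exists2 t, Gd d t & carries t [:: p] [:: q] k.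

Lemma reachesM p q r k h : reaches p q k -> reaches q r h -> reaches p r (k * h).
Proof.
move=> [t Gt tk] [s Gs sh]; exists (t * s); first exact: GdM.
exact: carriesM tk sh.
Qed.

(** Trivial sections are realized between any two letters by iterating skip. To
    realize a generator a_j at p, go from p to j, apply a_j, and return from j+1
    to p, the two journeys having trivial sections. *)
Lemma reaches_all p q k : Gd d k -> reaches p q k.
Proof.
have triv p' q' : reaches p' q' 1.
  apply: (ordSS_ind (P := fun j => reaches p' j 1) (i := p')).
    by exists 1; [apply: Gd1 |].
  move=> j rj.
  rewrite -[1]mulg1; apply: reachesM rj _.
  by exists (skip j); [apply: Gd_skip | apply: skip_carries0].
move=> Gk; suff r1 : reaches p p k by rewrite -[k]mulg1; apply: reachesM r1 (triv _ _).
apply: (Gd_ind (H := [set k | reaches p p k])) Gk => [|j].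
  apply/subgroupP; split; first exact: triv.
  move=> g h rg [t Gt th]; apply: reachesM rg _.
  by exists t^-1; [apply: GdV | apply: carriesV].
rewrite /= -[gen j]mulg1 -[gen j * 1]mul1g.
apply: reachesM (triv p j) (reachesM _ (triv (ordS j) p)).
by exists (gen j); [apply: Gd_gen | apply: gen_carriesL].
Qed.

Lemma Gd_level_transitive : level_transitive (Gd d).
Proof.
elim=> [|n IH] [|p u] [|q w] //= su sw; first by exists 1; rewrite //; apply: Gd1.
case: su sw => su [sw].
have [t Gt tp] := reaches_all p q Gd1.
have [k Gk kuw] := IH u w su sw.
have [s Gs sq] := reaches_all q q Gk.
exists (t * s); first exact: GdM.
by rewrite aut_mulE (tp u) [s _]sq /= kuw.
Qed.

End SelfSimilar.

(** * Sections of rigid stabilizers *)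

Section Rigid.
Local Open Scope classical_set_scope.
Local Open Scope group_scope.
Variable d : nat.
Implicit Types (g h k t c b : AutT d) (u v w : word d) (p q r i j : 'I_d).

Definition rigid u : set (AutT d) :=
  [set h | exists2 g, Rist (Gd d) u g & carries g u u h].

Lemma rigid_subgroup u : subgroup (rigid u).
Proof.
have sR := Rist_subgroup u (@Gd_subgroup d).
apply/subgroupP; split; first by exists 1; [apply: subgroup1 sR | apply: carries1].
move=> h k [g Rg gh] [t Rt tk]; exists (g * t^-1).
  by apply: subgroupM sR Rg (subgroupV sR Rt).
exact: carriesM gh (carriesV tk).
Qed.

Lemma Rist_letter p g :
  Gd d g -> (forall r, r != p -> carries g [:: r] [:: r] 1) -> Rist (Gd d) [:: p] g.
Proof.
move=> Gg g1; split=> // -[|r w]; first by rewrite aut_nil.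
by rewrite prefix_cons prefix0s andbT eq_sym => /g1/(_ w).
Qed.

Lemma Rist_letter_carries p g r :
  Rist (Gd d) [:: p] g -> r != p -> carries g [:: r] [:: r] 1.
Proof. by move=> [_ g1] rp v; apply: g1; rewrite /= prefix0s andbT eq_sym. Qed.

Lemma carries_letter_inj t p q r k h :
  carries t [:: p] [:: r] k -> carries t [:: q] [:: r] h -> p = q.
Proof.
move=> /carriesV/carries_aut tp /carriesV/carries_aut.
by rewrite tp => -[].
Qed.

(** Elements with only two nontrivial first-level sections: the letters p and q
    are thought of as two tokens carrying c and b, moved by conjugation. *)
Definition paired p q c b := p != q /\ exists g,
  [/\ Gd d g, carries g [:: p] [:: p] c, carries g [:: q] [:: q] b
    & forall r, r != p -> r != q -> carries g [:: r] [:: r] 1].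

Lemma paired_sym p q c b : paired p q c b -> paired q p b c.
Proof. by move=> [pq [g [? ? ? g1]]]; split; [rewrite eq_sym | exists g; split; auto]. Qed.

Lemma pairedJ p q p' q' c b t k l : paired p q c b -> Gd d t ->
  carries t [:: p] [:: p'] k -> carries t [:: q] [:: q'] l ->
  paired p' q' (c ^ k) (b ^ l).
Proof.
move=> [pq [g [Gg gp gq g1]]] Gt tp tq; split.
  apply: contra pq => /eqP e; rewrite -e in tq.
  by rewrite (carries_letter_inj tp tq).
exists (g ^ t); split; try exact: carriesJ.
  exact: subgroupJ (@Gd_subgroup d) Gg Gt.
move=> r rp rq; have [s [m [_ sr]]] := (Gd_section1 Gt).2 r.
rewrite -(conj1g m); apply: carriesJ (sr); apply: g1.
- apply: contra rp => /eqP e; rewrite e in sr.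
  by have := carries_aut sr; rewrite (carries_aut tp) => -[->].
- apply: contra rq => /eqP e; rewrite e in sr.
  by have := carries_aut sr; rewrite (carries_aut tq) => -[->].
Qed.

Lemma paired_div p q c c' b :
  paired p q c b -> paired p q c' b -> rigid [:: p] (c * c'^-1).
Proof.
move=> [pq [g [Gg gp gq g1]]] [_ [h [Gh hp hq h1]]].
exists (g * h^-1); last exact: carriesM gp (carriesV hp).
apply: Rist_letter => [|r rp]; first exact: GdM Gg (GdV Gh).
have [->|rq] := eqVneq r q.
  by rewrite -(mulgV b); apply: carriesM gq (carriesV hq).
by rewrite -(mulgV 1); apply: carriesM (g1 r rp rq) (carriesV (h1 r rp rq)).
Qed.

(** The supports of the two elements meet in p only, so their commutator is
    trivial at every other letter. *)
Lemma paired_comm p q q' c c' b b' :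
  q != q' -> paired p q c b -> paired p q' c' b' -> rigid [:: p] [~ c, c'].
Proof.
move=> qq [pq [g [Gg gp gq g1]]] [pq' [h [Gh hp hq h1]]].
have comm_carries r k l : carries g [:: r] [:: r] k -> carries h [:: r] [:: r] l ->
    carries [~ g, h] [:: r] [:: r] [~ k, l].
  by move=> gr hr; rewrite !commgEl; apply: carriesM (carriesV gr) (carriesJ gr hr).
exists [~ g, h]; last exact: comm_carries.
apply: Rist_letter => [|r rp].
  by rewrite commgEl; apply: GdM (GdV Gg) (subgroupJ (@Gd_subgroup d) Gg Gh).
have [->|rq] := eqVneq r q.
  by rewrite -(commg1 b); apply: comm_carries => //; apply: h1 => //; rewrite eq_sym.
have [->|rq'] := eqVneq r q'.
  by rewrite -(comm1g b'); apply: comm_carries => //; apply: g1; rewrite eq_sym.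
by rewrite -(commg1 1); apply: comm_carries; [apply: g1 | apply: h1].
Qed.

(** In the product of the first two elements with the inverse of the third, the
    sections at q and r cancel. *)
Lemma paired_triangle p q r c b e :
  paired p q c b -> paired p r c e -> paired q r b e -> rigid [:: p] (c * c).
Proof.
move=> [pq [g [Gg gp gq g1]]] [pr [h [Gh hp hr h1]]] [qr [k [Gk kq kr k1]]].
have [qp rp] : q != p /\ r != p by rewrite !(eq_sym _ p).
exists (g * h * k^-1); last first.
  rewrite -[c * c]mulg1 -invg1.
  exact: carriesM (carriesM gp hp) (carriesV (k1 p pq pr)).
apply: Rist_letter => [|s sp]; first exact: GdM (GdM Gg Gh) (GdV Gk).
have [->|sq] := eqVneq s q.
  have <- : b * 1 * b^-1 = 1 by rewrite mulg1 mulgV.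
  exact: carriesM (carriesM gq (h1 q qp qr)) (carriesV kq).
have [->|sr] := eqVneq s r.
  have <- : 1 * e * e^-1 = 1 by rewrite mul1g mulgV.
  by apply: carriesM (carriesM (g1 r rp _) hr) (carriesV kr); rewrite eq_sym.
have <- : 1 * 1 * 1^-1 = 1 :> AutT d by rewrite mulg1 mulgV.
exact: carriesM (carriesM (g1 s sp sq) (h1 s sp sr)) (carriesV (k1 s sq sr)).
Qed.

Hypotheses (d3 : 3 <= d) (dodd : odd d).

(** Conjugating by an element that takes p to q with section k. In particular the
    sections of rigid stabilizers of letters form one and the same normal
    subgroup for all letters. *)
Lemma rigid_letterJ p q c k : Gd d k -> rigid [:: p] c -> rigid [:: q] (c ^ k).
Proof.
move=> Gk [g Rg gc]; have [Gg _] := Rg.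
have [t Gt tk] := reaches_all d3 dodd p q Gk.
exists (g ^ t); last exact: carriesJ.
apply: Rist_letter => [|r rq]; first exact: subgroupJ (@Gd_subgroup d) Gg Gt.
have [s [m [_ sr]]] := (Gd_section1 Gt).2 r.
rewrite -(conj1g m); apply: carriesJ (sr); apply: Rist_letter_carries Rg _.
apply: contra rq => /eqP e; rewrite e in sr.
by have := carries_aut sr; rewrite (carries_aut tk) => -[->].
Qed.

Lemma rigid_letter p q c : rigid [:: p] c -> rigid [:: q] c.
Proof. by rewrite -{2}(conjg1 c); apply: rigid_letterJ; apply: Gd1. Qed.

(** The section at i of the square of gen i. *)
Definition gen_pair i := gen i * gen (ordS i).

Lemma paired_sqr i : paired i (ordS i) (gen_pair i) (gen (ordS i) * gen i).
Proof.
have Si := ordS_neq d3 i.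
split; first by rewrite eq_sym.
exists (gen i * gen i); split.
- exact: GdM (Gd_gen i) (Gd_gen i).
- exact: carriesM (gen_carriesL i) (gen_carriesR Si).
- exact: carriesM (gen_carriesR Si) (gen_carriesL i).
- move=> r ri rS; rewrite -(mulg1 1).
  exact: carriesM (gen_carriesD ri rS) (gen_carriesD ri rS).
Qed.

(** The first token goes from p+3 to p + d by steps of length two, without ever
    touching the second token at p+1; the distance d - 3 is even. *)
Lemma paired_around p c b :
  paired (ordS (ordS (ordS p))) (ordS p) c b -> paired p (ordS p) c b.
Proof.
move=> P0; set i := ordS p in P0 *.
have move_on n : n.*2.+2 < d -> paired (iter n.*2.+2 (@ordS d) i) i c b.
  elim: n => [//|n IH]; rewrite doubleS => lt.
  have := IH (ltnW (ltnW lt)).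
  set j := iter n.*2.+2 _ i => Pj.
  rewrite -[c]conjg1 -[b]conjg1.
  apply: pairedJ Pj (Gd_skip j) (skip_carries0 d3 j) (skip_carriesD _ _ _);
    rewrite eq_sym.
  - by apply: iter_ordS_neq; rewrite /= ?(ltnW lt) ?(ltnW (ltnW lt)).
  - by apply: (@iter_ordS_neq _ n.*2.+3 i); rewrite /= ?(ltnW lt) ?(ltnW (ltnW lt)).
  - by apply: (@iter_ordS_neq _ n.*2.+4 i); rewrite /= lt.
have e : (d - 3)./2.*2.+2 = d.-1.
  have := odd_double_half (d - 3); rewrite oddB // dodd /= add0n => ->.
  by rewrite -(subnK d3) addnK addn3.
have -> : p = iter (d - 3)./2.*2.+2 (@ordS d) i.
  rewrite e /i -iterSr prednK ?(ltn_trans _ d3) //.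
  by apply: val_inj; rewrite /= iter_ordS modnDr modn_small.
by apply: move_on; rewrite e prednK // (ltn_trans _ d3).
Qed.

(** The four elements A, B, B', C with two nontrivial sections are compared: B'
    and C differ only at p, and A, B, B' form a triangle. *)
Lemma gen_pair_relations i :
  rigid [:: i] (gen i * gen (ordS i) * (gen (ordS i) * gen i)^-1) /\
  rigid [:: i] (gen_pair i ^+ 2).
Proof.
rewrite -(ord_predK i); set p := ord_pred i; set a := ordS p.
have pa : a != p := ordS_neq d3 p.
have pSa : ordS a != p := ordSS_neq d3 p.
have aSa : ordS a != a := ordS_neq d3 a.
have A := paired_sqr a.
have B : paired p a (gen_pair a) (gen_pair a).
  apply: paired_around.
  have := pairedJ A (Gd_skip a) (skip_carries0 d3 a) (skip_carries1 d3 a).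
  by rewrite conjg1 [X in paired _ _ _ X]conjgE invgK !mulgA mulgK.
have B' : paired p (ordS a) (gen_pair a) (gen (ordS a) * gen a).
  have := pairedJ B (Gd_gen a) (gen_carriesD _ _) (gen_carriesL a).
  rewrite conjg1 [X in paired _ _ _ X]conjgE !mulgA mulVg mul1g.
  by apply; rewrite eq_sym.
have C : paired p (ordS a) (gen (ordS a) * gen a) (gen (ordS a) * gen a).
  apply: paired_sym.
  have := pairedJ A (GdV (Gd_skip p)) (carriesV (skip_carries2 d3 p))
    (carriesV (skip_carries0 d3 p)).
  by rewrite invg1 conjg1 -/a [X in paired _ _ X]conjgE invgK /gen_pair !mulgA mulgK.
split; first by apply: rigid_letter (paired_div B' C).
by rewrite expg2; apply: paired_triangle A (paired_sym B) (paired_sym B').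
Qed.

(** The square of gen j is moved so that one of its sections lies at i; should the
    other then lie at i+1, as for the square of gen i, it is pushed on to i+2. *)
Lemma gen_pair_comm i j : rigid [:: i] [~ gen_pair i, gen_pair j].
Proof.
have Ai := paired_sqr i.
have [t Gt ti] := reaches_all d3 dodd j i (@Gd1 d).
have [q [l [_ tq]]] := (Gd_section1 Gt).1 (ordS j).
have Aj := pairedJ (paired_sqr j) Gt ti tq; rewrite conjg1 in Aj.
have [e|nq] := eqVneq (ordS i) q; last exact: paired_comm nq Ai Aj.
rewrite -e in Aj.
have Aj' := pairedJ Aj (Gd_gen (ordS i))
  (gen_carriesD (r := i) _ _) (gen_carriesL (ordS i)).
rewrite -[gen_pair j]conjg1.
apply: paired_comm Ai (Aj' _ _); rewrite eq_sym; first exact: ordS_neq.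
- exact: ordS_neq.
- exact: ordSS_neq.
Qed.

Lemma subgroup_gen_pairs (H : set (AutT d)) i :
  subgroup H -> H (gen i) -> (forall j, H (gen_pair j)) -> forall j, H (gen j).
Proof.
move=> sH Hi He; apply: (ordS_ind Hi) => j Hj.
have -> : gen (ordS j) = (gen j)^-1 * gen_pair j by rewrite mulgA mulVg mul1g.
by apply: subgroupM => //; apply: subgroupV.
Qed.

(** Modulo the normal subgroup R, gen i commutes with gen (i+1), hence with
    gen_pair i; these products commute with each other, so each of them commutes
    with every generator, and then so does every generator. The squares of
    consecutive generators are inverse to each other modulo R, so those at
    distance two are equal; as d is odd, all squares are equal, and hence equal
    to their own inverses. *)
Lemma index_finite_letter p : index_finite (Gd d) (rigid [:: p]).
Proof.
pose R := rigid [:: p].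
have sG := @Gd_subgroup d.
have sR : subgroup R := rigid_subgroup [:: p].
have nR (c k : AutT d) : R c -> Gd d k -> R (c ^ k).
  by move=> Rc Gk; apply: rigid_letterJ Gk Rc.
have sC s (Gs : Gd d s) := centralizer_mod_subgroup sG sR nR Gs.
have symC s t (Gs : Gd d s) := @centralizer_mod_sym _ (Gd d) R sR s t Gs.
have Ge i : Gd d (gen_pair i) := GdM (Gd_gen i) (Gd_gen (ordS i)).
have Cgg s : Gd d s -> centralizer_mod (Gd d) R s s.
  by move=> Gs; split; rewrite ?commgg //; apply: subgroup1.
have commS i : R [~ gen i, gen (ordS i)].
  have := nR _ (gen (ordS i) * gen i) (rigid_letter p (gen_pair_relations i).1)
    (GdM (Gd_gen _) (Gd_gen _)).
  by rewrite conjgE commgEl conjgE !invgM !mulgA !mulgVK.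
have Cge i : centralizer_mod (Gd d) R (gen i) (gen_pair i).
  apply: subgroupM (sC _ (Gd_gen i)) (Cgg _ (Gd_gen i)) _.
  by split; [apply: Gd_gen | apply: commS].
have Cee i j : centralizer_mod (Gd d) R (gen_pair i) (gen_pair j).
  by split=> //; apply: rigid_letter (gen_pair_comm i j).
have Ceg i : forall j, centralizer_mod (Gd d) R (gen_pair i) (gen j).
  apply: (@subgroup_gen_pairs _ i) => //; first exact: sC.
  by apply: symC (Cge i); apply: Gd_gen.
have Cg i : forall j, centralizer_mod (Gd d) R (gen i) (gen j).
  apply: (@subgroup_gen_pairs _ i) => [||j]; first exact: sC (Gd_gen i).
  - exact: Cgg (Gd_gen i).
  - exact: symC (Ge j) (Ceg j i).
have sqr i : R (gen i ^+ 2 * gen (ordS i) ^+ 2).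
  apply: (mod_sqr_mul sR nR) => //; first exact: Gd_gen.
  exact: rigid_letter (gen_pair_relations i).2.
have GX i n : Gd d (gen i ^+ n) := subgroupX n sG (Gd_gen i).
have sqrC i := mod_conjC nR (GX i 2) (sqr i).
have sqr_eq i j : R (gen i ^+ 2 * (gen j ^+ 2)^-1).
  apply: (ordSS_ind dodd (P := fun j => R (gen i ^+ 2 * (gen j ^+ 2)^-1)) (i := i)).
    by rewrite mulgV; apply: subgroup1.
  move=> k Rk; set a := gen (ordS (ordS k)).
  have := subgroupM sR (subgroupM sR Rk (sqr k)) (subgroupV sR (sqrC (ordS k))).
  move: (gen i ^+ 2) (gen k ^+ 2) (gen (ordS k) ^+ 2) (a ^+ 2) => ? ? ? ?.
  by rewrite invgM !mulgA mulgVK mulgK.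
have pow4 i : R (gen i ^+ 4).
  rewrite (expgnDr _ 2 2).
  have := subgroupM sR (sqr_eq i (ordS i)) (sqrC i).
  move: (gen i ^+ 2) (gen (ordS i) ^+ 2) => ? ?.
  by rewrite mulgA mulgVK.
apply: (abelian_torsion_index_finite sG sR nR (n := 4) (l := [seq gen i | i <- enum 'I_d])) => //.
- apply: Gd_ind => [|i]; first exact: gen_subgroup_subgroup.
  by apply: mem_gen_subgroup; apply/map_f/mem_enum.
- by move=> _ /mapP[i _ ->]; apply: Gd_gen.
- by move=> _ _ /mapP[i _ ->] /mapP[j _ ->]; have [] := Cg i j.
- by move=> _ /mapP[i _ ->].
Qed.

(** * All levels *)

(** The map taking a section h at u to its lift in the rigid stabilizer of u
    respects products, so the finite index of R at the letter p pulls back to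
    the sections whose lift lies in R. *)
Lemma index_finite_rigid u : index_finite (Gd d) (rigid u).
Proof.
elim: u => [|p u IH].
  exists unit, (fun=> tt) => g h Gg Gh _; exists (g * h^-1) => //.
  by split; [apply: GdM Gg (GdV Gh) | move=> w; rewrite prefix0s].
apply: index_finite_trans IH _.
have [F [phi phiP]] := index_finite_letter p.
pose lift h := xget 1 [set g | Rist (Gd d) u g /\ carries g u u h].
have liftP h : rigid u h -> Rist (Gd d) u (lift h) /\ carries (lift h) u u h.
  move=> [g Rg gh].
  by apply: (xgetPex 1 (P := [set g | Rist (Gd d) u g /\ carries g u u h])); exists g.
exists F, (phi \o lift) => h k /liftP[[Gh h1] hh] /liftP[[Gk k1] kk] /(phiP _ _ Gh Gk).
have [_ l1] : Rist (Gd d) u (lift h * (lift k)^-1).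
  apply: (subgroupM (Rist_subgroup u (@Gd_subgroup d))) => //.
  exact: (subgroupV (Rist_subgroup u (@Gd_subgroup d))).
move=> [g Rg gl].
have [] := Rist_cat gl Rg (carriesM hh (carriesV kk)) l1.
by exists g.
Qed.

(** The list l contains the vertices of level n at which f may still act
    nontrivially; multiplying by a rigid stabilizer element removes one. *)
Lemma rigid_sections_Rist_level n f (l : seq (word d)) :
  Gd d f ->
  (forall u, size u = n -> exists2 h, rigid u h & carries f u u h) ->
  (forall u, size u = n -> u \notin l -> carries f u u 1) ->
  Rist_level (Gd d) n f.
Proof.
elim: l f => [|u l IH] f Gf fR f1.
  have -> : f = 1; last exact: subgroup1 (gen_subgroup_subgroup _).
  apply: AutT_eq => w; have [le|lt] := leqP n (size w).
    by rewrite -(cat_take_drop n w) f1 // size_takel.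
  have [w' [h [sw _ fw]]] := Gd_section w Gf.
  (* f fixes an extension of w to level n, hence also its prefix w *)
  pose v := nseq (n - size w) (Ordinal (ltn_trans (ltn0Sn 1) d3)).
  have : f (w ++ v) = w ++ v.
    have /f1 : size (w ++ v) = n by rewrite size_cat size_nseq subnKC // ltnW.
    by move=> /(_ isT) /carries_aut.
  rewrite (carries_aut fw) fw => /eqP; rewrite eqseq_cat // => /andP[/eqP-> _].
  by [].
have [su|nu] := eqVneq (size u) n; last first.
  apply: IH => // w sw lw; apply: f1; rewrite // inE negb_or lw andbT.
  by apply: contra nu => /eqP <-; apply/eqP.
have [h [g [Gg g1] gu] fu] := fR u su.
have gw w : size w = n -> w != u -> carries g w w 1.
  by move=> sw wu v; apply: g1; rewrite prefixE su -sw take_size_cat.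
have -> : f = (f * g^-1) * g by rewrite mulgVK.
apply: (subgroupM (gen_subgroup_subgroup _)); last first.
  by apply: mem_gen_subgroup; exists u.
apply: IH => [|w sw|w sw lw]; first exact: GdM Gf (GdV Gg).
- have [->|wu] := eqVneq w u.
    exists 1; first exact: subgroup1 (rigid_subgroup u).
    by rewrite -(mulgV h); apply: carriesM fu (carriesV gu).
  have [k Rk fk] := fR w sw; exists k => //.
  by rewrite -[k]mulg1 -invg1; apply: carriesM fk (carriesV (gw w sw wu)).
- have [->|wu] := eqVneq w u.
    by rewrite -(mulgV h); apply: carriesM fu (carriesV gu).
  rewrite -(mulgV 1); apply: carriesM (carriesV (gw w sw wu)).
  by apply: f1; rewrite // inE negb_or wu.
Qed.

(** Two elements g and h that agree on level n and have congruent sections there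
    have a quotient that fixes level n with sections in rigid u at each u. *)
Lemma index_finite_Rist_level n : index_finite (Gd d) (Rist_level (Gd d) n).
Proof.
pose agree (u : n.-tuple 'I_d) g h := exists w k t,
  [/\ carries g u w k, carries h u w t & rigid u (k * t^-1)].
have fin (u : n.-tuple 'I_d) : finitely_many_classes (Gd d) (agree u).
  have [F [phi phiP]] := index_finite_rigid u.
  pose sec g := xget 1 [set h | Gd d h /\ carries g u (g u) h].
  have secP g : Gd d g -> [/\ size (g u) = n, Gd d (sec g) & carries g u (g u) (sec g)].
    move=> Gg; have [w [h [sw Gh gh]]] := Gd_section u Gg.
    have ew := carries_aut gh; rewrite -ew in sw gh.
    have [] := xgetPex 1 (P := [set h | Gd d h /\ carries g u (g u) h]).
      by exists h.
    by rewrite sw size_tuple.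
  exists (option (n.-tuple 'I_d) * F)%type, (fun g => (insub (g u), phi (sec g))).
  move=> g h /secP[sg Gsg gg] /secP[sh Gsh hh] [e /(phiP _ _ Gsg Gsh) r].
  have eu : g u = h u.
    move: e; case: insubP => [x _ <-|]; last by rewrite sg eqxx.
    by case: insubP => [y _ <- [->] |]; last by rewrite sh eqxx.
  by exists (g u), (sec g), (sec h); split; rewrite // eu.
have [|F [phi phiP]] := @finitely_many_classes_all _ _ (enum {: n.-tuple 'I_d}) (Gd d) agree.
  by move=> u _; apply: fin.
exists F, phi => g h Gg Gh e /=.
apply: (rigid_sections_Rist_level (l := map val (enum {: n.-tuple 'I_d}))) => [|u su|u su].
- exact: GdM Gg (GdV Gh).
- have [|w [k [t [gk ht r]]]] := phiP g h Gg Gh e (Tuple (introT eqP su)).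
    by rewrite mem_enum.
  by exists (k * t^-1) => //; apply: carriesM gk (carriesV ht).
- move=> /mapP[]; exists (Tuple (introT eqP su)) => //.
  by rewrite mem_enum.
Qed.

End Rigid.

Theorem theorem4p13 (d : nat) (hd3 : 3 <= d) (hodd : odd d) :
  branch_group (Gd d).
Proof.
split=> [||n]; first exact: Gd_subgroup.
  exact: Gd_level_transitive.
apply: index_finite_finite_index; first exact: gen_subgroup_subgroup.
exact: index_finite_Rist_level.
Qed.
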